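(* The antipode of the Hopf monoid of graphs $\mathbf G$ is given by the following cancellation-free and grouping-free expression. If $g$ is a graph on $I$ then $$\mathsf s_I(g)=\sum_{f,o}(-1)^{c(f)}\,g(f,o),$$ summing over all pairs of a flat $f$ of $g$ and an acyclic orientation $o$ of $g/f$, where $c(f)$ is the number of connected components of $f$.
   Context: A graph with (finite) vertex set $I$ is a finite multiset of edges, each edge being a subset of $I$ of cardinality $1$ (a half-edge) or $2$. $\mathrm G[I]$ is the set of graphs with vertex set $I$, and $\mathbf G[I]$ is the vector space with basis $\mathrm G[I]$ over a field of characteristic $0$. For an ordered decomposition $I=S\sqcup T$: the product of $g_1\in\mathrm G[S]$ and $g_2\in\mathrm G[T]$ is their disjoint union; the coproduct is $\Delta_{S,T}(g)=g|_S\otimes g/_S$, where $g|_S$ consists of the edges and half-edges of $g$ all of whose endpoints lie in $S$, and $g/_S$ is the graph on $T$ given by all edges and half-edges of $g$ incident to $T$, where an edge $\{t,s\}$ with $t\in T$, $s\in S$ becomes a half-edge $\{t\}$. These make $\mathbf G$ a connected Hopf monoid. With $\mu_{S_1,\dots,S_k},\Delta_{S_1,\dots,S_k}$ the iterated (co)products, the antipode is $\mathsf s_\emptyset=\mathrm{id}$ and $\mathsf s_I=\sum(-1)^k\mu_{S_1,\dots,S_k}\circ\Delta_{S_1,\dots,S_k}$ for $I\ne\emptyset$, over all $k\ge1$ and ordered sequences of nonempty pairwise disjoint $S_1,\dots,S_k$ with union $I$. A flat $f$ of $g$ is a set (sub-multiset) of two-vertex edges of $g$ such that for any cycle of $g$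 with edges $e_1,\dots,e_k$ (two parallel edges form a cycle), if $e_1,\dots,e_{k-1}\in f$ then $e_k\in f$. It is viewed as a graph on vertex set $I$, and $c(f)$ counts its connected components (isolated vertices included). $g/f$ is the graph obtained by contracting the edges of $f$; its two-vertex edges are those of $g$ not in $f$; an acyclic orientation of it is an orientation of these edges with no directed cycles. Given $f$ and $o$, $g(f,o)$ is the graph on $I$ obtained from $g$ by keeping $f$ (and all half-edges of $g$) intact and replacing each edge $\{i,j\}\notin f$ by the half-edge $\{i\}$ if $i\to j$ in $o$. An expression $\sum_\alpha c_\alpha x_\alpha$ in basis elements is cancellation-free if no $\alpha\ne\beta$ have $x_\alpha=x_\beta$ with $c_\alpha,c_\beta$ of opposite sign, and grouping-free if the $x_\alpha$ are pairwise distinct. *)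

(* Defs.v *)
From HB Require Import structures.
From mathcomp Require Import all_boot all_order all_algebra.
From mathcomp Require Import finmap multiset freeg.

Set Implicit Arguments.
Unset Strict Implicit.
Unset Printing Implicit Defensive.

Import GRing.Theory Num.Theory.

Local Open Scope ring_scope.
Local Open Scope mset_scope.

(** Vertex sets are the subsets [I] of an arbitrary finite type [T]. *)

Section Graphs.
Variable T : finType.
Implicit Types (I J S : {set T}) (s : seq {set T}).

Definition graph_on I s : bool :=
  all (fun e : {set T} => (e \subset I) && ((#|e| == 1%N) || (#|e| == 2%N))) s.

Record graph I := Graph {
  edge_mset :> {mset {set T}};
  edge_msetP : graph_on I edge_mset
}.

HB.instance Definition _ I := [isSub for @edge_mset I].
HB.instance Definition _ I := [Choice of graph I by <:].

Lemma graph_on_seq_mset I s : graph_on I s -> graph_on I (seq_mset s).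
Proof. by rewrite /graph_on (perm_all _ (perm_eq_seq_mset s)). Qed.

Definition graph_of_seq I s (h : graph_on I s) : graph I :=
  Graph (graph_on_seq_mset h).

Fact gunit_subproof : graph_on set0 [::]. Proof. by []. Qed.
Definition gunit : graph set0 := graph_of_seq gunit_subproof.

Fact gunion_subproof S J (g1 : graph S) (g2 : graph J) :
  graph_on (S :|: J) (g1 `+` g2).
Proof.
apply/allP=> e; rewrite in_msetD => /orP[] he.
  have /allP/(_ e he)/andP[eS ->] := edge_msetP g1.
  by rewrite andbT (subset_trans eS) // subsetUl.
have /allP/(_ e he)/andP[eS ->] := edge_msetP g2.
by rewrite andbT (subset_trans eS) // subsetUr.
Qed.

Definition gunion S J (g1 : graph S) (g2 : graph J) : graph (S :|: J) :=
  Graph (gunion_subproof g1 g2).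

Fact grestrict_subproof I S (g : graph I) :
  graph_on S [seq e : {set T} <- enum_mset g | e \subset S].
Proof.
apply/allP=> e; rewrite mem_filter => /andP[eS he].
by rewrite eS; have /allP/(_ e he)/andP[_ ->] := edge_msetP g.
Qed.

(** g|_S *)
Definition grestrict I S (g : graph I) : graph S :=
  graph_of_seq (grestrict_subproof S g).

Fact gquotient_subproof I J (g : graph I) :
  graph_on J [seq e :&: J | e : {set T} <- enum_mset g & e :&: J != set0].
Proof.
apply/allP=> _ /mapP[e + ->]; rewrite mem_filter => /andP[eJ he].
rewrite subsetIr /=; have /allP/(_ e he)/andP[_ ce] := edge_msetP g.
have := subset_leq_card (subsetIl e J); move: eJ; rewrite -card_gt0.
by case/orP: ce => /eqP->; case: #|_| => [|[|[|]]].
Qed.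

(** g/_S for I = S ⊔ J, in terms of the complement J of S only: an edge {t,s}
    with t in J and s in S meets J in the half-edge {t}. *)
Definition gquotient I J (g : graph I) : graph J :=
  graph_of_seq (gquotient_subproof J g).

Definition gcast I J (E : I = J) (g : graph I) : graph J :=
  ecast L (graph L) E g.

(** Over a field K, G[I] is [{freeg (graph I) / K}]; the tensor product
    G[S_1] ⊗ ... ⊗ G[S_k] of these free modules is the free module on tuples
    (g_1, ..., g_k) with g_i a graph on S_i. *)
Fixpoint graphs s : choiceType :=
  if s is A :: s' then (graph A * graphs s')%type else unit.

Definition union s : {set T} := foldr (@setU T) set0 s.

(** μ_{S_1,...,S_k} and Δ_{S_1,...,S_k} on basis elements: iterations of
    μ_{S,J}(g1 ⊗ g2) = gunion g1 g2 and
    Δ_{S,J}(g) = grestrict S g ⊗ gquotient J g. *)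
Fixpoint gunions s : graphs s -> graph (union s) :=
  if s is A :: s' return graphs s -> graph (union s)
  then fun gs => gunion gs.1 (gunions gs.2)
  else fun=> gunit.

Fixpoint gsplit s : graph (union s) -> graphs s :=
  if s is A :: s' return graph (union s) -> graphs s
  then fun g => (grestrict A g, gsplit (gquotient (union s') g))
  else fun=> tt.

Definition is_decomposition I s : bool :=
  [&& all (fun S : {set T} => S != set0) s,
      pairwise (fun S S' : {set T} => [disjoint S & S']) s
    & union s == I].

Definition decomposition I k := {s : k.-tuple {set T} | is_decomposition I s}.

Lemma decomposition_union I k (d : decomposition I k) : union (val d) = I.
Proof. by case/and3P: (valP d) => _ _ /eqP. Qed.

Section Linear.
Variable K : fieldType.

Definition linearize (A B : choiceType) (f : A -> B) :
    {freeg A / K} -> {freeg B / K} :=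
  fglift (fun a => << f a >> : {freeg B / K}).

Definition mu I k (d : decomposition I k) :
    {freeg (graphs (val d)) / K} -> {freeg (graph I) / K} :=
  linearize (fun gs => gcast (decomposition_union d) (gunions gs)).

Definition Delta I k (d : decomposition I k) :
    {freeg (graph I) / K} -> {freeg (graphs (val d)) / K} :=
  linearize (fun g => gsplit (gcast (esym (decomposition_union d)) g)).

(** A decomposition of I into nonempty parts has at most #|I| parts. *)
Definition antipode I (x : {freeg (graph I) / K}) : {freeg (graph I) / K} :=
  if I == set0 then x
  else \sum_(1 <= k < #|I|.+1) \sum_(d : decomposition I k)
         (-1) ^+ k *: mu (Delta d x).

End Linear.

Section FlatsOrientations.
Variables (I : {set T}) (g : graph I).

(** Occurrences of edges and half-edges in the multiset g; [tag e] is the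
    underlying set of endpoints. As two parallel edges form a cycle, a flat,
    taken below as a set of occurrences, has all or none of the copies of an
    edge, hence is the same thing as a sub-multiset. *)
Definition edge := {e : {set T} & 'I_(edge_mset g e)}.

Implicit Type f : {set edge}.

(** A tuple of length #|C| enumerating C has no repetition, so es lists each edge
    of the cycle once; [ordS] is the cyclic successor. *)
Definition is_cycle (C : {set edge}) : bool :=
  (1 < #|C|)%N &&
  [exists es : #|C|.-tuple edge, exists vs : #|C|.-tuple T,
    [&& C == [set e in es], uniq vs
      & [forall i, tag (tnth es i) == [set tnth vs i; tnth vs (ordS i)]]]].

Definition is_flat f : bool :=
  [forall e in f, #|tag e| == 2%N] &&
  [forall (C | is_cycle C), forall e in C, (C :\ e \subset f) ==> (e \in f)].

Definition adjacent f : rel T :=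
  [rel x y | [exists e in f, (x \in tag e) && (y \in tag e)]].

Definition component f (x : T) : {set T} := [set y | connect (adjacent f) x y].

(** The connected components of f, which are also the vertices of g/f. *)
Definition components f : {set {set T}} := [set component f x | x in I].

(** The two-vertex edges of g/f. *)
Definition in_contraction f : pred edge :=
  fun e => (e \notin f) && (#|tag e| == 2%N).

Definition contracted_edge f := {e : edge | in_contraction f e}.

(** An orientation of g/f is encoded by the source of each edge. *)
Definition is_orientation f (o : {ffun contracted_edge f -> T}) : bool :=
  [forall e, o e \in tag (val e)].

(** The arc i -> j of g, seen in g/f. *)
Definition arc f (o : {ffun contracted_edge f -> T}) : rel {set T} :=
  [rel B C | [exists e, exists j, [&& tag (val e) == [set o e; j],
                                      B == component f (o e)
                                    & C == component f j]]].

Definition is_acyclic f (o : {ffun contracted_edge f -> T}) : bool :=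
  ~~ [exists B, exists C, arc o B C && connect (arc o) C B].

Lemma is_acyclicP f (o : {ffun contracted_edge f -> T}) :
  reflect (forall c : seq {set T}, cycle (arc o) c -> c = [::]) (is_acyclic o).
Proof.
apply: (iffP idP) => [ac [|B c] //= cyc | noc].
  case/negP: ac; apply/existsP; exists B; apply/existsP.
  case: c cyc => [|C c] /=.
    by case/andP=> aBB _; exists B; rewrite aBB connect0.
  case/andP=> aBC cC; exists C; rewrite aBC; apply/connectP.
  by exists (rcons c B); rewrite ?last_rcons.
apply/negP=> /existsP[B /existsP[C /andP[aBC /connectP[c cC eB]]]].
suff /noc: cycle (arc o) (C :: c) by [].
by rewrite /= rcons_path cC -eB.
Qed.

Definition flat_orientation :=
  {p : {f : {set edge} & {ffun contracted_edge f -> T}} |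
    [&& is_flat (tag p), is_orientation (tagged p) & is_acyclic (tagged p)]}.

Definition flat_of (p : flat_orientation) : {set edge} := tag (val p).

Definition orient_edge (p : flat_orientation) (e : edge) : {set T} :=
  if insub e is Some e' then [set tagged (val p) e'] else tag e.

Fact orient_subproof (p : flat_orientation) :
  graph_on I [seq orient_edge p e | e : edge].
Proof.
apply/allP=> _ /mapP[e _ ->].
have eg : tag e \in edge_mset g.
  by rewrite in_mset; case: e => e i; apply: leq_ltn_trans (ltn_ord i).
have /allP/(_ _ eg) := edge_msetP g.
rewrite /orient_edge; case: insubP => [e' _ ee'|//] /andP[eI _].
rewrite cards1 andbT sub1set (subsetP eI) //.
by have /and3P[_ /forallP/(_ e') + _] := valP p; rewrite ee'.
Qed.

(** g(f,o) *)
Definition orient (p : flat_orientation) : graph I :=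
  graph_of_seq (orient_subproof p).

End FlatsOrientations.

End Graphs.

(** The expression is \sum_a c_a x_a; its signs are those of integer
    coefficients, since the base field carries no order. *)
Definition cancellation_free (A B : Type) (c : A -> int) (x : A -> B) : Prop :=
  forall a b, a <> b -> x a = x b -> ~ (c a * c b < 0).

Definition grouping_free (A B : Type) (x : A -> B) : Prop :=
  forall a b, a <> b -> x a <> x b.

(* Main.v *)
Require Import Defs.
From mathcomp Require Import all_boot all_order all_algebra.
From mathcomp Require Import finmap multiset freeg.

(** The composite of Delta and mu along an ordered decomposition (S_1, ..., S_k)
    sends g to a single graph: an edge inside a block survives, and an edge
    between two blocks shrinks to a half-edge at its endpoint in the later
    block. Only the function sending a vertex to the index of its block
    matters, so any height function h on the vertices may be considered: its
    level edges form a flat f, the other edges, oriented downhill, form an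
    acyclic orientation o of g/f, and the graph above is g(f,o)
    ([mu_Delta], [orient_edge_height]).

    The antipode is thereby a sum over pairs (f,o), and the coefficient of
    g(f,o) is the sum of (-1)^k over the decompositions that induce (f,o).
    By [height_orientation_eq] these are the decompositions whose index is
    constant on each component of f and decreases strictly along the arcs of
    the acyclic digraph g/f; in other words, the ordered set
    partitions of the poset P of the c(f) vertices of g/f in which each block
    is an antichain and comparable elements appear in order. Their signed
    count is (-1)^c(f) ([sum_compatible_decompositions]), by induction on P: the first
    block is a nonempty set A of minimal elements, so the count a(P) satisfies
    a(P) = - sum_A a(P - A) = - (-1)^|P| sum_A (-1)^|A|, and the alternating
    sum over all subsets A of the nonempty set of minimal elements, the empty
    one included, vanishes.

    Since g(f,o) determines (f,o) ([orient_inj]), nothing can be grouped, let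
    alone cancelled. The flat is read off from the two-vertex edges of
    g(f,o). If o and o' have the same numbers of half-edges at all vertices,
    then whenever they disagree on an edge with o-source x they also disagree
    on an edge with o'-source x; following such edges never ends, against
    acyclicity. *)

Set Implicit Arguments.
Unset Strict Implicit.
Unset Printing Implicit Defensive.

Import GRing.Theory.

Local Open Scope ring_scope.

(** * Alternating sums and acyclic relations *)

(** Both sides are the expanded product of the factors 1 - 1 over M. *)
Lemma sum_sign_subsets (V : finType) (M : {set V}) :
  \sum_(B : {set V} | B \subset M) (-1) ^+ #|B| = (M == set0)%:R :> int.
Proof.
pose F v : int := if v \in M then -1 else 0.
transitivity (\prod_v (F v + 1)).
  rewrite bigA_distr [RHS](bigID (fun B : {set V} => B \subset M)) /=.
  rewrite [X in _ + X]big1 ?addr0 => [|B /subsetPn[v vB vM]]; last first.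
    by rewrite (bigD1 v) //= vB /F (negPf vM) mul0r.
  apply: eq_bigr => B /subsetP BM; rewrite -big_mkcond /=.
  rewrite (eq_bigr (fun=> -1)) => [|v /BM]; last by rewrite /F => ->.
  by rewrite prodr_const.
case: eqVneq => [M0|/set0Pn[v vM]].
  by rewrite big1 // => v _; rewrite /F M0 inE add0r.
by rewrite (bigD1 v) //= /F vM addNr mul0r.
Qed.

Section Acyclic.
Variables (V : finType) (r : rel V).

(** This is [is_acyclic] for an arbitrary relation; the two are convertible. *)
Definition acyclic : bool := ~~ [exists B, exists C, r B C && connect r C B].

(** A vertex of W that reaches the fewest vertices is a sink: for an arc v -> w,
    the set reached from w is contained in the one reached from v and misses v. *)
Lemma exists_sink (W : {set V}) : acyclic -> W != set0 ->
  exists2 v, v \in W & {in W, forall w, ~~ r v w}.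
Proof.
move=> ac /set0Pn[v0 Wv0].
pose reach v := [set w | connect r v w].
case: (@arg_minnP _ v0 [in W] (fun v => #|reach v|) Wv0) => v Wv min_v.
exists v => // w Ww; apply/negP=> vw.
have := min_v w Ww; rewrite leqNgt => /negP; apply; apply: proper_card.
apply/properP; split.
  apply/subsetP=> z; rewrite !inE; exact: connect_trans (connect1 vw).
exists v; rewrite inE ?connect0 //; apply: contra ac => wv.
by apply/existsP; exists v; apply/existsP; exists w; rewrite vw.
Qed.

Lemma connect_leq (H : V -> nat) : (forall v w, r v w -> (H w <= H v)%N) ->
  forall v w, connect r v w -> (H w <= H v)%N.
Proof.
move=> rH v w /connectP[l rl ->]; elim: l v rl => //= z l IHl v /andP[vz zl].
exact: leq_trans (IHl z zl) (rH v z vz).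
Qed.

Lemma acyclic_rank (H : V -> nat) :
  (forall v w, r v w -> (H w < H v)%N) -> acyclic.
Proof.
move=> rH; apply/negP=> /existsP[v /existsP[w /andP[/rH vw]]].
move/(connect_leq (fun v w rvw => ltnW (rH v w rvw))); rewrite leqNgt vw //.
Qed.

End Acyclic.

(** * Ordered decompositions *)

Section Rank.
Variable T : finType.
Implicit Types (U A S : {set T}) (s : seq {set T}) (x y : T).

Definition rank s x : nat := find (fun S : {set T} => x \in S) s.

Lemma rank_cons A s x : rank (A :: s) x = if x \in A then 0%N else (rank s x).+1.
Proof. by []. Qed.

Lemma is_decomposition0 U : is_decomposition U [::] = (U == set0).
Proof. by rewrite /is_decomposition /= eq_sym. Qed.

Lemma all_disjoint_union A s :
  all (fun S => [disjoint A & S]) s = [disjoint A & union s].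
Proof.
elim: s => [|S s IHs] /=; first by rewrite -setI_eq0 setI0 eqxx.
by rewrite IHs -!setI_eq0 setIUr setU_eq0.
Qed.

Lemma is_decomposition_cons U A s : is_decomposition U (A :: s) =
  [&& A != set0, A \subset U & is_decomposition (U :\: A) s].
Proof.
rewrite /is_decomposition /= all_disjoint_union.
case: (A != set0) => //=; case: (all _ s) => /=; last by rewrite andbF.
case: (pairwise _ s) => /=; last by rewrite !andbF.
apply/andP/andP=> [[dA /eqP<-]|[AU /eqP->]].
  rewrite andbT in dA; split; first exact: subsetUl.
  by rewrite setDUl setDv set0U (setDidPl _) // disjoint_sym.
split; first by rewrite andbT -setI_eq0 setDE setICA setICr setI0.
by rewrite -{1}(setIidPr AU) setID.
Qed.

Lemma is_decomposition_set0 s : is_decomposition set0 s = (s == [::]).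
Proof.
case: s => [|A s]; first by rewrite is_decomposition0 eqxx.
by rewrite is_decomposition_cons subset0; case: (A == set0).
Qed.

Variables (V : finType) (c : T -> V) (r : rel V).

(** Arcs lead from later blocks to earlier ones, as the endpoint of a cut edge
    that keeps a half-edge, the source in g(f,o), lies in the later block. *)
Definition compatible U s : bool :=
  [forall x in U, forall y in U,
    ((c x == c y) ==> (rank s x == rank s y)) &&
    (r (c x) (c y) ==> (rank s y < rank s x)%N)].

Lemma compatibleP U s :
  reflect ({in U &, forall x y, (c x = c y -> rank s x = rank s y) /\
                        (r (c x) (c y) -> (rank s y < rank s x)%N)})
          (compatible U s).
Proof.
apply: (iffP forall_inP) => [cs x y Ux Uy | cs x Ux].
  have /forall_inP/(_ y Uy)/andP[/implyP h1 /implyP h2] := cs x Ux.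
  by split=> // /eqP/h1/eqP.
apply/forall_inP=> y Uy; have [h1 h2] := cs x y Ux Uy.
by apply/andP; split; apply/implyP=> // /eqP/h1->.
Qed.

Definition sinks (W : {set V}) := [set v in W | [forall w in W, ~~ r v w]].

(** A set is the first block of a compatible decomposition of U when it is a
    union of fibres of c over sinks: an arc leaving the first block would need a
    block before it. *)
Definition first_block U A : bool :=
  [&& A == U :&: c @^-1: (c @: A) & c @: A \subset sinks (c @: U)].

Lemma compatible_cons U A s : A \subset U ->
  compatible U (A :: s) = first_block U A && compatible (U :\: A) s.
Proof.
move=> /subsetP AU; apply/compatibleP/andP => [cs | [/andP[/eqP eA mA] cs]].
  split.
    apply/andP; split.
      apply/eqP/setP=> y; rewrite inE; apply/idP/andP=> [Ay | [Uy]].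
        by rewrite AU // inE imset_f.
      rewrite inE => /imsetP[x Ax]; have [+ _] := cs _ _ Uy (AU x Ax).
      move=> /[apply]; rewrite !rank_cons Ax.
      by case: (y \in A).
    apply/subsetP=> _ /imsetP[x Ax ->]; rewrite inE imset_f ?AU //=.
    apply/forall_inP=> _ /imsetP[y Uy ->]; apply/negP.
    by have [_ /[apply]] := cs x y (AU x Ax) Uy; rewrite !rank_cons Ax.
  apply/compatibleP=> x y /setDP[Ux nAx] /setDP[Uy nAy].
  have := cs x y Ux Uy; rewrite !rank_cons (negPf nAx) (negPf nAy).
  by case=> h1 h2; split=> [/h1[]|/h2].
move=> x y Ux Uy; rewrite !rank_cons.
have memA z : z \in U -> (z \in A) = (c z \in c @: A).
  by move=> Uz; rewrite {1}eA !inE Uz.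
split=> [cxy|rxy].
  have eAxy: (x \in A) = (y \in A) by rewrite !memA ?cxy.
  rewrite eAxy; case: ifP => // nAy; congr _.+1.
  by have [|| + _] := compatibleP _ _ cs x y; rewrite ?inE ?eAxy ?nAy //; exact.
have nAx : x \notin A.
  apply/negP=> Ax; have := subsetP mA _ (imset_f c Ax).
  by rewrite inE => /andP[_ /forall_inP/(_ (c y) (imset_f c Uy))/negP].
rewrite (negPf nAx); case: ifP => // nAy; rewrite ltnS.
by have [|| _] := compatibleP _ _ cs x y; rewrite ?inE ?nAx ?nAy //; exact.
Qed.

End Rank.

(** * Signed count of compatible decompositions *)

Lemma big_tuple_cons (R : Type) (idx : R) (op : Monoid.com_law idx)
    (A : finType) k (P : pred (seq A)) (F : seq A -> R) :
  \big[op/idx]_(t : k.+1.-tuple A | P t) F t =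
  \big[op/idx]_(a : A) \big[op/idx]_(t : k.-tuple A | P (a :: t)) F (a :: t).
Proof.
rewrite pair_big_dep /= (reindex (fun p : A * k.-tuple A => cons_tuple p.1 p.2)) //=.
exists (fun t => (thead t, behead_tuple t)) => [[a t] _|t _] /=.
  by congr (_, _); apply: val_inj.
by rewrite [RHS]tuple_eta; apply: val_inj.
Qed.

Lemma big_tuple0 (R : Type) (idx : R) (op : Monoid.com_law idx)
    (A : finType) (P : pred (seq A)) (F : seq A -> R) :
  \big[op/idx]_(t : 0.-tuple A | P t) F t = if P [::] then F [::] else idx.
Proof.
rewrite big_mkcond (bigD1 [tuple]) //= big1 ?Monoid.mulm1 // => t.
by case/eqP; apply: tuple0.
Qed.

Section Count.
Variables (T V : finType) (c : T -> V) (r : rel V).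

(** A first block is recovered from its image under c, as the preimage in U. *)
Lemma reindex_first_blocks (R : zmodType) (U : {set T}) (F : {set V} -> R) :
  \sum_(A : {set T} | [&& A != set0, A \subset U & first_block c r U A])
    F (c @: A) =
  \sum_(B : {set V} | (B \subset sinks r (c @: U)) && (B != set0)) F B.
Proof.
have cK (B : {set V}) : B \subset c @: U -> c @: (U :&: c @^-1: B) = B.
  move=> /subsetP BU; apply/setP=> v; apply/imsetP/idP => [[x]|Bv].
    by rewrite !inE => /andP[_ Bx] ->.
  have /imsetP[x Ux ev] := BU v Bv; exists x => //.
  by rewrite !inE Ux -ev.
have sinksS : sinks r (c @: U) \subset c @: U.
  by apply/subsetP=> v; rewrite inE => /andP[].
rewrite [RHS](reindex_onto (fun A : {set T} => c @: A) (fun B => U :&: c @^-1: B)).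
  apply: eq_bigl => A; rewrite imset_eq0 /first_block [A == U :&: _]eq_sym.
  apply/and3P/andP=> [[-> AU /andP[-> ->]]|[/andP[-> ->] /eqP eA]] //.
  by rewrite eA eqxx -eA subsetIl.
by move=> B /andP[BS _]; rewrite cK // (subset_trans BS).
Qed.

(** The bound n only has to exceed the number of blocks, which is at most #|U|;
    leaving it free lets the induction reuse the same range for U minus its
    first block. The empty decomposition, counted for k = 0, makes the formula
    hold for U empty. *)
Lemma sum_compatible_decompositions n (U : {set T}) : acyclic r -> (#|U| < n)%N ->
  \sum_(k < n) \sum_(t : k.-tuple {set T} |
      is_decomposition U t && compatible c r U t) (-1) ^+ k
  = (-1) ^+ #|c @: U| :> int.
Proof.
move=> ac; elim: n U => [//|n IHn] U; rewrite ltnS => Un.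
rewrite big_ord_recl /=.
rewrite (@big_tuple0 _ _ _ _ (fun t => is_decomposition U t && compatible c r U t)
  (fun=> 1)) is_decomposition0.
(* The first term is the case k = 0; the others are grouped by first block A,
   whose removal leaves a shorter decomposition of U :\: A. *)
transitivity ((U == set0)%:R -
  \sum_(A : {set T} | [&& A != set0, A \subset U & first_block c r U A])
     (-1) ^+ #|c @: U| * (-1) ^+ #|c @: A| : int).
  congr (_ + _).
    case: eqVneq => [->|] //=.
    by case: compatibleP => // -[] x; rewrite inE.
  rewrite (eq_bigr (fun k : 'I_n => \sum_(A : {set T} |
     [&& A != set0, A \subset U & first_block c r U A])
    - \sum_(t : k.-tuple {set T} | is_decomposition (U :\: A) t &&
           compatible c r (U :\: A) t) (-1) ^+ k)); last first.
    move=> k _.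
    rewrite (@big_tuple_cons _ _ _ _ _
      (fun t => is_decomposition U t && compatible c r U t) (fun=> (-1) ^+ k.+1)).
    rewrite [RHS]big_mkcond; apply: eq_bigr => A _.
    rewrite (eq_bigl (fun t : k.-tuple {set T} =>
       [&& A != set0, A \subset U & first_block c r U A] &&
       (is_decomposition (U :\: A) t && compatible c r (U :\: A) t))); last first.
      move=> t /=; rewrite is_decomposition_cons.
      case: (A != set0) => //=; case: (boolP (A \subset U)) => //= AU.
      by rewrite compatible_cons // andbCA.
    case: ifP => _ /=; last by rewrite big_pred0.
    by rewrite -sumrN; apply: eq_bigr => t _; rewrite exprS mulN1r.
  rewrite exchange_big -sumrN; apply: eq_bigr => A /and3P[A0 AU bA].
  rewrite sumrN IHn; last first.
    apply: leq_trans Un; rewrite cardsDS // ltn_subrL !card_gt0 A0.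
    by apply: contraNneq A0 => U0; rewrite -subset0 -U0.
  have AcU : c @: A \subset c @: U by apply: imsetS.
  have -> : c @: (U :\: A) = c @: U :\: c @: A.
    case/andP: bA => /eqP eA _.
    apply/setP=> v; rewrite inE; apply/imsetP/andP=> [[x /setDP[Ux nAx] ->]|].
      by split; [apply: contra nAx; rewrite {2}eA !inE Ux | apply: imset_f].
    case=> vA /imsetP[x Ux ev]; exists x => //; rewrite inE Ux andbT.
    by apply: contra vA; rewrite ev => /(imset_f c).
  rewrite -{1}(subnK (subset_leq_card AcU)) exprD -mulrA -expr2 sqrr_sign mulr1.
  by rewrite cardsDS.
rewrite (reindex_first_blocks U (fun B => (-1) ^+ #|c @: U| * (-1) ^+ #|B|)).
rewrite -mulr_sumr.
have := sum_sign_subsets (sinks r (c @: U)).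
rewrite (bigD1 set0) ?sub0set //= cards0 expr0 => /(canRL (addKr _))->.
(* A nonempty image has a sink, so the alternating sum over all sets of sinks,
   the empty one included, vanishes unless U is empty. *)
have -> : (sinks r (c @: U) == set0) = (U == set0).
  rewrite -(imset_eq0 c U); apply/eqP/eqP=> [S0 | ->]; last first.
    by apply/setP=> v; rewrite !inE.
  apply/eqP; apply: contraT => /(exists_sink ac)[v Wv sv].
  suff: v \in sinks r (c @: U) by rewrite S0 inE.
  by rewrite inE Wv; apply/forall_inP.
case: (eqVneq U set0) => [->|_].
  by rewrite imset0 cards0 /= expr0 addNr mulr0 subr0.
by rewrite /= addr0 mulrN1 opprK add0r.
Qed.

End Count.

(** * Graphs cut by a height function *)

Section Graphs.
Variable T : finType.
Implicit Types (A U I : {set T}) (s : seq {set T}) (h : T -> nat).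

(** For a height that is the index of a block, this is what remains of the edge
    e in the graph cut along the blocks. *)
Definition highest h (e : {set T}) : {set T} :=
  [set x in e | [forall y in e, (h y <= h x)%N]].

Lemma highest_const h (e : {set T}) :
  {in e &, forall x y, h x = h y} -> highest h e = e.
Proof.
move=> hc; apply/setP=> x; rewrite inE; case: (boolP (x \in e)) => //= xe.
by apply/forall_inP=> y ye; rewrite (hc y x).
Qed.

Lemma const_highest h (e : {set T}) :
  highest h e = e -> {in e &, forall x y, h x = h y}.
Proof.
move=> he x y; rewrite -{1 2}he !inE.
move=> /andP[xe /forall_inP hx] /andP[ye /forall_inP hy].
by apply/eqP; rewrite eqn_leq hx // hy.
Qed.

Lemma highest_set2 h x y : (h y < h x)%N -> highest h [set x; y] = [set x].
Proof.
move=> hyx; apply/setP=> z; rewrite !inE; apply/andP/eqP=> [[/orP[]/eqP-> //]|->].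
  by move/forall_inP/(_ x (set21 _ _)); rewrite leqNgt hyx.
rewrite eqxx; split=> //; apply/forall_inP=> w /set2P[]-> //; exact: ltnW.
Qed.

Lemma highest_set2_lt h x y :
  highest h [set x; y] = [set x] -> x != y -> (h y < h x)%N.
Proof.
move=> tx xy; rewrite ltnNge; apply/negP=> le_xy.
suff: y \in highest h [set x; y] by rewrite tx inE eq_sym (negPf xy).
by rewrite inE set22; apply/forall_inP=> z /set2P[]->.
Qed.

Lemma highest_neq0 h (e : {set T}) : e != set0 -> exists x, x \in highest h e.
Proof.
case/set0Pn=> x0 x0e; case: (@arg_maxnP _ x0 [in e] h x0e) => x xe max_x.
by exists x; rewrite inE xe; apply/forall_inP.
Qed.

Lemma highest_card1 h (e : {set T}) : #|e| = 1%N -> highest h e = e.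
Proof.
by move/eqP/cards1P=> [x ->]; apply: highest_const => y z /set1P-> /set1P->.
Qed.

(** One step of the iterated coproduct: an edge that meets the later blocks
    loses its endpoints in the first one, and this does not change which of its
    endpoints lie highest. *)
Lemma highest_rank_cons A s (e : {set T}) :
  [disjoint A & union s] -> e \subset A :|: union s -> e :&: union s != set0 ->
  highest (rank (A :: s)) e = highest (rank s) (e :&: union s).
Proof.
move=> dA /subsetP eAs /set0Pn[z /setIP[ze zs]].
have notA x : x \in union s -> (x \in A) = false.
  by move=> xs; apply: (disjointFl dA).
apply/setP=> x; rewrite !inE -andbA; case: (boolP (x \in e)) => //= xe.
apply/forall_inP/andP=> [max_x|[xs /forall_inP max_x] y ye].
  have xA : (x \in A) = false.
    by have := max_x z ze; rewrite (notA z zs); case: ifP.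
  have xs : x \in union s by have := eAs x xe; rewrite inE xA.
  split=> //; apply/forall_inP=> y /setIP[ye ys].
  by have := max_x y ye; rewrite xA (notA y ys).
rewrite (notA x xs); case: ifP => // yA.
rewrite ltnS max_x // inE ye; have := eAs y ye; by rewrite inE yA.
Qed.

Lemma edge_subset_card I (g : graph I) (e : {set T}) :
  e \in enum_mset g -> e \subset I /\ (#|e| = 1%N \/ #|e| = 2%N).
Proof.
move=> eg; have /allP/(_ e eg)/andP[-> ce] := edge_msetP g; split=> //.
by case/orP: ce => /eqP; [left|right].
Qed.

Lemma edge_neq0 I (g : graph I) (e : {set T}) : e \in enum_mset g -> e != set0.
Proof.
by move=> /edge_subset_card[_ ce]; rewrite -card_gt0; case: ce => ->.
Qed.

Lemma graph_set0 (g : graph (set0 : {set T})) : enum_mset g = [::].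
Proof.
case E: (enum_mset g) => [//|e l].
have eg : e \in enum_mset g by rewrite E inE eqxx.
by have [] := edge_subset_card eg; rewrite subset0 (negPf (edge_neq0 eg)).
Qed.

Lemma perm_enum_msetD (M N : multiset {set T}) :
  perm_eq (enum_mset (M `+` N)%mset) (enum_mset M ++ enum_mset N).
Proof.
by apply/allP=> e _ /=; rewrite count_cat !count_mem_mset msetE2.
Qed.

(** The induction follows the recursion on the blocks: the edges inside the
    first block A are set aside, and those that meet the later blocks are
    exactly the others, since A is disjoint from the later blocks. *)
Lemma gunions_gsplit s (g : graph (union s)) :
  pairwise (fun S S' : {set T} => [disjoint S & S']) s ->
  perm_eq (gunions (gsplit g)) [seq highest (rank s) e | e <- enum_mset g].
Proof.
elim: s g => [|A s IHs] g /=; 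
  first by rewrite (graph_set0 g) (graph_set0 (gunit T)) perm_refl.
rewrite all_disjoint_union => /andP[dA ds].
apply: perm_trans (perm_enum_msetD _ _) _.
have := IHs (gquotient (union s) g) ds.
move/(perm_trans)/(_ (perm_map _ (perm_eq_seq_mset _)))=> IH.
apply: perm_trans (perm_cat (perm_eq_seq_mset _) IH) _.
have meets_tail (e : {set T}) :
    e \in enum_mset g -> (e :&: union s != set0) = ~~ (e \subset A).
  move=> /edge_subset_card[/subsetP es _]; apply/set0Pn/subsetPn=> -[x].
    by case/setIP=> xe xs; exists x; rewrite // (disjointFl dA xs).
  by move=> xe /negPf xA; exists x; have := es x xe; rewrite !inE xe xA.
have := perm_map (highest (rank (A :: s)))
  (introT permPl (perm_filterC (fun e : {set T} => e \subset A) (enum_mset g))).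
rewrite map_cat => H; apply: perm_trans H.
apply/permP=> a; congr (count a (_ ++ _)).
  rewrite -[LHS]map_id; apply/eq_in_map=> e.
  rewrite mem_filter => /andP[/subsetP eA _].
  by rewrite highest_const // => x y /eA xA /eA yA; rewrite !rank_cons xA yA.
rewrite (eq_in_filter meets_tail) -map_comp.
apply/eq_in_map=> e; rewrite mem_filter /= => /andP[eA eg].
have [es _] := edge_subset_card eg; rewrite highest_rank_cons //.
by rewrite meets_tail.
Qed.

Section Orientations.
Variables (I : {set T}) (g : graph I).
Implicit Types (e : edge g) (f : {set edge g}) (p q : flat_orientation g).

Lemma mem_tag (e : edge g) : tag e \in enum_mset g.
Proof. by rewrite in_mset; case: e => e i; apply: leq_ltn_trans (ltn_ord i). Qed.

Lemma perm_tags : perm_eq [seq tag e | e : edge g] (enum_mset g).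
Proof.
apply/allP=> S _; apply/eqP; rewrite /= count_mem_mset -sum1_count big_image_cond /=.
transitivity (\sum_(S' | S' == S) \sum_(j < edge_mset g S') 1)%N.
  by rewrite sig_big_dep; apply: eq_bigl => p; rewrite andbT.
by rewrite big_pred1_eq sum1_card card_ord.
Qed.

Lemma perm_map_tags (R : eqType) (F : {set T} -> R) :
  perm_eq [seq F (tag e) | e : edge g] [seq F A | A <- enum_mset g].
Proof. by have := perm_map F perm_tags; rewrite -map_comp. Qed.

Lemma is_flatP f : reflect
  ((forall e : edge g, e \in f -> #|tag e| = 2%N) /\
   (forall C, is_cycle C ->
      forall e : edge g, e \in C -> C :\ e \subset f -> e \in f))
  (is_flat f).
Proof.
apply: (iffP andP) => [[/forall_inP f2 /forall_inP fC]|[f2 fC]].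
  split=> [e /f2/eqP //|C cC e eC]; exact/implyP/(forall_inP (fC C cC)).
split; first by apply/forall_inP=> e /f2->.
apply/forall_inP=> C cC; apply/forall_inP=> e eC; apply/implyP; exact: fC.
Qed.

(** Two parallel edges form a cycle, so a flat contains all copies of an edge or
    none. *)
Lemma is_cycle_pair (e e' : edge g) :
  tag e = tag e' -> e != e' -> #|tag e| = 2%N -> is_cycle [set e; e'].
Proof.
move=> ee' ne /eqP/cards2P[x [y [xy exy]]]; rewrite /is_cycle.
have -> : #|[set e; e']| = 2%N by rewrite cards2 ne.
rewrite /=; apply/existsP; exists [tuple e; e'].
apply/existsP; exists [tuple x; y]; apply/and3P; split.
- by apply/eqP/setP=> z; rewrite !inE.
- by rewrite /= inE xy.
apply/forallP=> -[[|[|//]] lti];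
  rewrite !(tnth_nth e) !(tnth_nth x) /= ?modnn -?ee' exy //.
by rewrite setUC.
Qed.

(** The differences of h along a cycle add up to zero; if all but one of them
    vanish, so does the last. *)
Lemma cycle_const f h C : is_cycle C ->
  (forall e : edge g, e \in f -> {in tag e &, forall x y, h x = h y}) ->
  forall e : edge g, e \in C -> C :\ e \subset f ->
  {in tag e &, forall x y, h x = h y}.
Proof.
case/andP=> _ /existsP[es /existsP[vs /and3P[/eqP eC _ /forallP ends]]] hf e.
have es_inj : injective (tnth es).
  apply/tuple_uniqP/card_uniqP; rewrite size_tuple {2}eC.
  by apply: eq_card => z; rewrite inE.
have memC z : (z \in C) = (z \in es) by rewrite {1}eC inE.
rewrite memC => /tnthP[i ei] /subsetP Cf.
have sum0 : \sum_j ((h (tnth vs (ordS j)))%:Z - (h (tnth vs j))%:Z) = 0.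
  rewrite sumrB -(reindex_inj (@ordS_inj _) (P := xpredT)
    (F := fun j => (h (tnth vs j))%:Z)); exact: subrr.
have : h (tnth vs (ordS i)) = h (tnth vs i).
  move: sum0; rewrite (bigD1 i) //= big1 ?addr0 => [/eqP|j ji].
    by rewrite subr_eq0 => /eqP[].
  apply/eqP; rewrite subr_eq0; apply/eqP; congr (_%:Z).
  have eE := eqP (ends j).
  apply: (hf (tnth es j)); rewrite ?eE ?set21 ?set22 //.
  apply: Cf; rewrite in_setD1 ei (inj_eq es_inj) ji /= memC; exact: mem_tnth.
by move=> hi x y; rewrite ei (eqP (ends i)) => /set2P[]-> /set2P[]->.
Qed.

Lemma cycle_tag_card C e : is_cycle C -> e \in C -> #|tag e| = 2%N.
Proof.
case/andP=> C1 /existsP[es /existsP[vs]].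
case/and3P=> /eqP eC /tuple_uniqP vs_inj /forallP ends.
have -> : (e \in C) = (e \in es) by rewrite {1}eC inE.
case/tnthP=> i ->; rewrite (eqP (ends i)) cards2 (inj_eq vs_inj).
suff -> : i != ordS i by [].
apply/eqP=> /(congr1 val) /=; case: (ltngtP i.+1 #|C|) (ltn_ord i) =>
  [lti _|//|eqi _].
  by rewrite modn_small // => /eqP; rewrite eqn_leq ltnn andbF.
by rewrite eqi modnn => i0; move: C1; rewrite -eqi i0.
Qed.

Lemma tag_card (e : edge g) : #|tag e| = 1%N \/ #|tag e| = 2%N.
Proof. by have [] := edge_subset_card (mem_tag e). Qed.

(** The three fates of an edge in g(f,o), with what remains of it there and
    whether it belongs to f. *)
Variant edge_spec p (e : edge g) : {set T} -> bool -> Prop :=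
  | FlatEdge of e \in flat_of p & #|tag e| = 2%N : edge_spec p e (tag e) true
  | HalfEdge of #|tag e| = 1%N : edge_spec p e (tag e) false
  | OrientedEdge x y of x != y & tag e = [set x; y]
      & Defs.arc (tagged (val p))
          (component (flat_of p) x) (component (flat_of p) y) :
      edge_spec p e [set x] false.

Lemma edgeP p (e : edge g) : edge_spec p e (orient_edge p e) (e \in flat_of p).
Proof.
have /and3P[/is_flatP[f2 _] /forallP ori _] := valP p.
case: (boolP (e \in flat_of p)) => ef.
  rewrite /orient_edge insubN; last by rewrite /in_contraction ef.
  by apply: FlatEdge => //; apply: f2.
rewrite /orient_edge; case: insubP => [e' /andP[_ e2] ee'|]; last first.
  rewrite /in_contraction ef /= => /eqP e2.
  by apply: HalfEdge; case: (tag_card e).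
have /cards2P[x [y [xy exy]]] := e2.
have [z [zx ezx]] : exists z,
    tagged (val p) e' != z /\ tag e = [set tagged (val p) e'; z].
  have := ori e'; rewrite ee' exy => /set2P[]->; first by exists y.
  by exists x; rewrite eq_sym setUC.
apply: (OrientedEdge zx ezx); apply/existsP; exists e'; apply/existsP; exists z.
by rewrite ee' ezx !eqxx.
Qed.

(** An oriented edge drops to a half-edge, so the flat consists of the
    two-vertex edges that are left intact. *)
Lemma mem_flat_of p (e : edge g) :
  (e \in flat_of p) = (#|tag e| == 2%N) && (orient_edge p e == tag e).
Proof.
case: edgeP => [_ ->|->|x y xy ->] //; first by rewrite !eqxx.
rewrite cards2 xy /= => _; apply/esym/eqP=> /(congr1 (fun A : {set T} => #|A|)).
by rewrite cards1 cards2 xy.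
Qed.

(** The flat is determined by [mem_flat_of], and outside of it the half-edge
    left over is the source. *)
Lemma orient_edge_inj p q : orient_edge p =1 orient_edge q -> p = q.
Proof.
move=> pq; have fpq : flat_of p = flat_of q.
  by apply/setP=> e; rewrite !mem_flat_of pq.
apply: val_inj; move: pq fpq; rewrite /orient_edge /flat_of.
case: (val p) => f o; case: (val q) => f' o' /= pq ff'; subst f'.
congr Tagged; apply/ffunP=> e; have := pq (val e).
by rewrite valK => /set1_inj.
Qed.

(** * Recovering a flat and an orientation from the graph they define *)

(** An edge of the flat of p survives in the graph, so some parallel copy of it
    survives for q, and hence the edge itself lies in the flat of q. *)
Lemma flat_of_sub p q :
  orient p = orient q -> flat_of p \subset flat_of q.
Proof.
move=> /(congr1 (@edge_mset T I))/eq_seq_msetP/perm_mem pq.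
apply/subsetP=> e; rewrite mem_flat_of => /andP[/eqP e2 /eqP pe].
have : orient_edge p e \in [seq orient_edge p e | e : edge g] by apply: image_f.
rewrite pq pe => /imageP[e' _ ee'].
have : e' \in flat_of q.
  move: ee' e2; case: edgeP => // [e'1 -> | x y _ _ _ ->]; first by rewrite e'1.
  by rewrite cards1.
rewrite mem_flat_of -ee' => /andP[_ /eqP te'].
have [-> //|ne] := eqVneq e e'; first by rewrite mem_flat_of -ee' -te' e2 !eqxx.
have /and3P[/is_flatP[_ fC] _ _] := valP q.
apply: (fC [set e; e']); rewrite ?set21 //; first exact: is_cycle_pair.
apply/subsetP=> z; rewrite !inE => /andP[/negPf->] /= /eqP->.
by rewrite mem_flat_of -ee' -te' e2 !eqxx.
Qed.

Lemma card_orient_edge p q : orient p = orient q -> forall S,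
  #|[set e | orient_edge p e == S]| = #|[set e | orient_edge q e == S]|.
Proof.
move=> /(congr1 (@edge_mset T I))/eq_seq_msetP/permP pq S.
have := pq (pred1 S); rewrite -!sum1_count !big_image_cond /= => pqS.
by rewrite -!sum1dep_card.
Qed.

(** Let D be the set of edges that p and q treat differently. Every edge of D
    is oriented by both, in opposite directions. If e in D has p-source x, then
    some e' in D has q-source x, because p and q give x equally many
    half-edges; the other end of e' is its p-source. So in the q-orientation
    there is no sink among the p-sources of D. *)
Lemma orient_inj : injective (@orient T I g).
Proof.
move=> p q epq.
have fpq : flat_of p = flat_of q.
  by apply/eqP; rewrite eqEsubset !flat_of_sub.
apply: orient_edge_inj => e0; apply/eqP; apply: contraT => ne0.
pose D := [set e | orient_edge p e != orient_edge q e].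
have D_arc e : e \in D -> exists x y, [/\ orient_edge p e = [set x],
    orient_edge q e = [set y] &
    Defs.arc (tagged (val q))
      (component (flat_of q) y) (component (flat_of q) x)].
  have : (e \in flat_of p) = (#|tag e| == 2%N) && (orient_edge q e == tag e).
    by rewrite fpq mem_flat_of.
  rewrite inE.
  case: (edgeP p e) => [_ e2|e1|x y xy exy _].
  - by case/esym/andP=> _ /eqP->; rewrite eqxx.
  - case: (edgeP q e); rewrite ?eqxx // => x y xy exy.
    by rewrite exy cards2 xy in e1.
  case: (edgeP q e) => [||x' y' x'y' exy' a' _ ne]; rewrite ?exy ?cards2 ?xy //.
    by rewrite eqxx.
  have xx' : x != x' by apply: contraNneq ne => ->.
  have exy2 : x = y'.
    have : x \in tag e by rewrite exy set21.
    by rewrite exy' => /set2P[ex|//]; rewrite ex eqxx in xx'.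
  by exists x, x'; split=> //; rewrite exy2.
pose W := [set component (flat_of q) x |
  x in [set x | [exists e in D, orient_edge p e == [set x]]]].
have [||v /imsetP[x]] := exists_sink (r := Defs.arc (tagged (val q))) (W := W).
- by have /and3P[] := valP q.
- have [|x [y [px _ _]]] := D_arc e0; first by rewrite inE.
  apply/set0Pn; exists (component (flat_of q) x); apply: imset_f; rewrite inE.
  by apply/existsP; exists e0; rewrite inE ne0 px eqxx.
rewrite inE => /existsP[e /andP[De /eqP ex]] -> sink.
have /subsetPn[e'] : ~~ ([set e | orient_edge q e == [set x]] \subset
                         [set e | orient_edge p e == [set x]]).
  apply/negP=> sub; have /eqP := card_orient_edge epq [set x].
  rewrite eq_sym => /eqP/(subset_cardP)/(_ sub)/(_ e).
  rewrite !inE ex eqxx => /eqP qx.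
  by move: De; rewrite inE ex qx eqxx.
rewrite !inE => /eqP qx px.
have [|x' [y' [px' qy' a]]] := D_arc e'; first by rewrite inE qx.
have yx : y' = x by apply: set1_inj; rewrite -qy' qx.
have Wx' : component (flat_of q) x' \in W.
  apply: imset_f; rewrite inE; apply/existsP; exists e'.
  by rewrite inE px' eqxx qx andbT -px'.
by have := sink _ Wx'; rewrite -yx a.
Qed.

(** * The flat and the orientation of a height function *)

Section Height.
Variable h : T -> nat.

Definition height_flat : {set edge g} :=
  [set e : edge g | (#|tag e| == 2%N) && (highest h (tag e) == tag e)].

Definition height_source (e : edge g) : T :=
  xchoose (highest_neq0 h (edge_neq0 (mem_tag e))).

Lemma height_sourceP (e : edge g) : e \notin height_flat -> #|tag e| = 2%N ->
  exists y, [/\ tag e = [set height_source e; y],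
                (h y < h (height_source e))%N
              & highest h (tag e) = [set height_source e]].
Proof.
rewrite inE => + e2; rewrite e2 eqxx /= => te.
have /eqP/cards2P[x [y [xy exy]]] := e2.
have [z [w [ezw hwz]]] : exists z w, tag e = [set z; w] /\ (h w < h z)%N.
  case: (ltngtP (h x) (h y)) => hxy.
  - by exists y, x; rewrite setUC.
  - by exists x, y.
  case/eqP: te; rewrite exy; apply: highest_const.
  by move=> ? ? /set2P[]-> /set2P[]->.
have tz : highest h (tag e) = [set z] by rewrite ezw highest_set2.
have -> : height_source e = z.
  apply/set1P; rewrite -tz; exact: (xchooseP (highest_neq0 h _)).
by exists w.
Qed.

(** A height that is level on the edges of f descends to the vertices of g/f. *)
Lemma connected_const f :
  (forall e, e \in f -> {in tag e &, forall x y, h x = h y}) ->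
  forall x y, y \in component f x -> h x = h y.
Proof.
move=> hf x y; rewrite inE => cxy.
have cl : closed (adjacent f) [pred z | h z == h x].
  move=> z w /existsP[e /andP[ef /andP[ze we]]].
  by rewrite !inE (hf e ef z w).
by have := closed_connect cl cxy; rewrite !inE eqxx => /esym/eqP.
Qed.

Lemma height_flat_const (e : edge g) :
  e \in height_flat -> {in tag e &, forall x y, h x = h y}.
Proof. by rewrite inE => /andP[_ /eqP/const_highest]. Qed.

(** The level edges, and the others oriented downhill. *)
Definition height_tagged : {f : {set edge g} & {ffun contracted_edge f -> T}} :=
  existT _ height_flat [ffun e => height_source (val e)].

Fact height_subproof :
  [&& is_flat (tag height_tagged), is_orientation (tagged height_tagged)
    & is_acyclic (tagged height_tagged)].
Proof.
apply/and3P; split.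
- apply/is_flatP; split=> [e|C cC e eC Ce]; first by rewrite inE => /andP[/eqP].
  rewrite inE (cycle_tag_card cC eC) eqxx /=.
  by rewrite (highest_const (cycle_const cC height_flat_const eC Ce)).
- apply/forallP=> e; rewrite ffunE.
  have : height_source (val e) \in highest h (tag (val e)).
    exact: (xchooseP (highest_neq0 h _)).
  by rewrite inE => /andP[].
pose H (S : {set T}) := \max_(z in S) h z.
have Hc x : H (component height_flat x) = h x.
  have xx : x \in component height_flat x by rewrite inE connect0.
  rewrite /H (eq_bigr (fun=> h x)) => [|z zx].
    apply/eqP; rewrite eqn_leq; apply/andP; split; first exact/bigmax_leqP.
    exact: (leq_bigmax_cond (F := fun=> h x) x xx).
  by rewrite -(connected_const height_flat_const zx).
(* The maximum of h over a component is the common value of h on it, which the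
   arcs decrease. *)
apply: (acyclic_rank (H := H)) => B C /existsP[e /existsP[j]].
rewrite ffunE => /and3P[/eqP ej /eqP-> /eqP->]; rewrite !Hc.
have /andP[nf /eqP e2] := valP e.
have [y [ey lty _]] := height_sourceP nf e2.
have : j \in tag (val e) by rewrite ej set22.
rewrite ey => /set2P[ejs|-> //].
by move: e2; rewrite ej -ejs setUid cards1.
Qed.

Definition height_orientation : flat_orientation g :=
  exist _ height_tagged height_subproof.

Lemma orient_edge_height (e : edge g) :
  orient_edge height_orientation e = highest h (tag e).
Proof.
rewrite /orient_edge; case: insubP => [e' /andP[nf /eqP e2] ee'|nc] /=.
  rewrite ffunE ee'; rewrite /= in nf e2.
  by have [y [_ _ ->]] := height_sourceP nf e2.
case: (tag_card e) => [/highest_card1-> //|e2].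
move: nc; rewrite /in_contraction e2 eqxx andbT negbK /=.
by rewrite inE => /andP[_ /eqP->].
Qed.

End Height.

Lemma component_adj p e x y : e \in flat_of p -> x \in tag e -> y \in tag e ->
  component (flat_of p) x = component (flat_of p) y.
Proof.
move=> ef xe ye.
have sym : connect_sym (adjacent (flat_of p)).
  apply: sym_connect_sym => u v; apply: eq_existsb => e'.
  by rewrite [(u \in _) && _]andbC.
apply/setP=> z; rewrite !inE; apply: (same_connect sym).
by apply: connect1; apply/existsP; exists e; rewrite ef xe ye.
Qed.

(** The orientation induced by the blocks s is p exactly when every edge keeps
    the same endpoints for both. For the level edges and the downhill ones this
    gives the two halves of compatibility. *)
Lemma height_orientation_eq p s :
  (height_orientation (rank s) == p) =
  compatible (component (flat_of p)) (Defs.arc (tagged (val p))) I s.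
Proof.
apply/eqP/compatibleP => [ep x y _ _|cs].
  have tr e : orient_edge p e = highest (rank s) (tag e).
    by rewrite -ep orient_edge_height.
  have hc := @connected_const (rank s) (flat_of p) _.
  have {}hc u v : component (flat_of p) u = component (flat_of p) v ->
      rank s u = rank s v.
    move=> euv; apply: hc; last by rewrite euv inE connect0.
    by move=> e; rewrite mem_flat_of tr => /andP[_ /eqP/const_highest].
  split; first exact: hc.
  case/existsP=> e /existsP[j /and3P[/eqP ej /eqP/hc-> /eqP/hc->]].
  have := tr (val e); rewrite /orient_edge valK ej => /esym/highest_set2_lt; apply.
  have := valP e; rewrite /in_contraction /= ej cards2.
  by case: (_ != j); rewrite ?andbF.
apply: orient_edge_inj => e; rewrite orient_edge_height.
have eI x : x \in tag e -> x \in I.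
  by have [/subsetP sI _] := edge_subset_card (mem_tag e); apply: sI.
case: (edgeP p e) eI => [ef e2 | e1 | x y xy exy a] eI.
- apply: highest_const => x y xe ye.
  have [hc _] := cs x y (eI x xe) (eI y ye).
  exact: hc (component_adj ef xe ye).
- exact: highest_card1.
rewrite exy in eI *; rewrite highest_set2 //.
by have [_ /(_ a)] := cs x y (eI x (set21 _ _)) (eI y (set22 _ _)).
Qed.

End Orientations.
End Graphs.

(** * The antipode *)

Lemma edge_mset_gcast (T : finType) (I J : {set T}) (E : I = J) (g : graph I) :
  edge_mset (gcast E g) = edge_mset g.
Proof. by case: J / E. Qed.

Lemma graph_inj (T : finType) (I : {set T}) (g1 g2 : graph I) :
  perm_eq (enum_mset g1) (enum_mset g2) -> g1 = g2.
Proof.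
by move=> /eq_seq_msetP; rewrite !seq_mset_id => ?; apply: val_inj.
Qed.

Section Antipode.
Variables (K : fieldType) (T : finType) (I : {set T}) (g : graph I).

Lemma linearizeU (A B : choiceType) (f : A -> B) (a : A) :
  linearize f (<< a >> : {freeg A / K}) = << f a >>.
Proof. by rewrite /linearize liftU scale1r. Qed.

Lemma mu_Delta k (d : decomposition I k) :
  mu (Delta d << g >>) =
    << orient (height_orientation g (rank (val d))) >> :> {freeg (graph I) / K}.
Proof.
rewrite /mu /Delta !linearizeU; congr (<< _ >>).
apply: graph_inj; rewrite edge_mset_gcast.
have /and3P[_ dd _] := valP d.
apply: perm_trans (gunions_gsplit _ dd) _; rewrite edge_mset_gcast.
rewrite perm_sym; apply: perm_trans (perm_eq_seq_mset _) _.
have -> : [seq orient_edge (height_orientation g (rank (val d))) e | e : edge g]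
        = [seq highest (rank (val d)) (tag e) | e : edge g].
  by apply: eq_map => e; apply: orient_edge_height.
exact: perm_map_tags.
Qed.

(** The range starts at k = 0: the empty sequence is a decomposition only of the
    empty set, for which it accounts for the separate case of the antipode. *)
Lemma antipodeE : antipode (<< g >> : {freeg (graph I) / K}) =
  \sum_(k < #|I|.+1) \sum_(t : k.-tuple {set T} | is_decomposition I t)
    (-1) ^+ k *: << orient (height_orientation g (rank t)) >>.
Proof.
rewrite big_ord_recl (@big_tuple0 _ _ _ _ (is_decomposition I)
  (fun t => (-1) ^+ 0 *: << orient (height_orientation g (rank t)) >>)).
rewrite is_decomposition0 /antipode; case: eqVneq => [I0|_].
  have dE s : is_decomposition I s = (s == [::]).
    by rewrite I0 is_decomposition_set0.
  rewrite big1 => [|k _]; last first.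
    by rewrite big_pred0 // => t; rewrite dE; case: t => -[].
  rewrite addr0 scale1r; congr (<< _ >>).
  by apply: graph_inj; move: g; rewrite I0 => g'; rewrite !graph_set0.
rewrite add0r big_add1 big_mkord; apply: eq_bigr => k _.
have := @big_sub _ _ +%R _ (fun t : k.+1.-tuple {set T} => is_decomposition I t)
  (fun t => (-1) ^+ k.+1 *: << orient (height_orientation g (rank t)) >>
      : {freeg (graph I) / K}).
move=> /esym/(etrans _); apply.
by apply: eq_bigr => d _; rewrite mu_Delta.
Qed.

End Antipode.

Theorem corollary13p7 (K : fieldType) (charK : [pchar K] =i pred0)
    (T : finType) (I : {set T}) (g : graph I) :
  let sign (p : flat_orientation g) : int :=
    (-1) ^+ #|components (flat_of p)| in
  [/\ antipode (<< g >> : {freeg (graph I) / K}) =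
        \sum_(p : flat_orientation g) (sign p)%:~R *: << orient p >>,
      cancellation_free sign (@orient T I g)
    & grouping_free (@orient T I g)].
Proof.
move=> sign; split; last first.
- by move=> p q pq /orient_inj.
- by move=> p q pq /orient_inj.
rewrite antipodeE.
transitivity (\sum_(k < #|I|.+1) \sum_(p : flat_orientation g)
  \sum_(t : k.-tuple {set T} | is_decomposition I t &&
      (height_orientation g (rank t) == p)) (-1) ^+ k *: << orient p >>
    : {freeg (graph I) / K}).
  apply: eq_bigr => k _.
  rewrite (partition_big
    (fun t : k.-tuple {set T} => height_orientation g (rank t)) xpredT) //=.
  by apply: eq_bigr => p _; apply: eq_bigr => t /andP[_ /eqP->].
rewrite exchange_big /=; apply: eq_bigr => p _.
have /and3P[_ _ ac] := valP p.
rewrite /sign.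
rewrite -(@sum_compatible_decompositions _ _ (component (flat_of p)) _ #|I|.+1 I ac) //.
rewrite rmorph_sum scaler_suml /=; apply: eq_bigr => k _.
rewrite rmorph_sum scaler_suml /=; apply: eq_big => [t|t _].
  by rewrite height_orientation_eq.
by rewrite rmorphXn rmorphN1.
Qed.
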